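(* Let $\Bbbk$ be a field and let $\sigma_{inv}$ be the automorphism of $\Bbbk[h^{\pm 1}]$ with $\sigma_{inv}(h)=h^{-1}$. The center of the generalized Weyl algebra $\Bbbk[h^{\pm 1}](\sigma_{inv},1)$ is isomorphic to the ring $\Bbbk[h+h^{-1},x^{\pm 2}]$, i.e. the commutative ring of polynomials in $h+h^{-1}$ and Laurent polynomials in $x^2$.
   Context: For a $\Bbbk$-algebra $R$, a $\Bbbk$-algebra automorphism $\sigma$ of $R$ and a central element $a\in R$, the (degree-one) generalized Weyl algebra $R(\sigma,a)$ is the $\Bbbk$-algebra extension of $R$ generated by two indeterminates $x$ and $y$ subject to the relations $yx=a$, $xy=\sigma(a)$, $xr=\sigma(r)x$ and $yr=\sigma^{-1}(r)y$ for all $r\in R$. When $a=1$ one has $y=x^{-1}$. In $\Bbbk[h+h^{-1},x^{\pm2}]$ the elements $h+h^{-1}$ and $x^2$ are algebraically independent over $\Bbbk$, and $x^2$ is inverted. *)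

(* Defs.v *)
From HB Require Import structures.
From mathcomp Require Import all_boot all_order all_algebra.
From mathcomp Require Import generic_quotient finmap.
From mathcomp Require Import boolp.
From mathcomp.multinomials Require Import monalg.

Set Implicit Arguments.
Unset Strict Implicit.
Unset Printing Implicit Defensive.

Import GRing.Theory.

Local Open Scope quotient_scope.
Local Open Scope ring_scope.

(* [{malg R[int]}] only carries its module structure: the ring structure of
   [monalg] needs a [monomType], whose only invertible element is the unit. *)
Definition laurent (R : comNzRingType) : Type := {malg R[int]}.

HB.instance Definition _ (R : comNzRingType) :=
  GRing.Lmodule.copy (laurent R) {malg R[int]}.

Section Laurent.
Variable R : comNzRingType.
Implicit Types (p q r : laurent R) (c d : R) (i j : int).

Definition laurentM (c : R) (i : int) : laurent R := mkmalgU i c.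

Definition laurent_mul p q : laurent R :=
  \sum_(i <- msupp p) \sum_(j <- msupp q) laurentM (p@_i * q@_j) (i + j).

Lemma laurentM0 i : laurentM 0 i = 0.
Proof. exact: monalgU0. Qed.

Lemma laurentMD i : {morph laurentM^~ i : c d / c + d}.
Proof. exact: monalgUD. Qed.

Lemma laurentE p : p = \sum_(i <- msupp p) laurentM p@_i i.
Proof. exact: monalgE. Qed.

Lemma laurent_sum_incl (F : int -> R -> laurent R) (d : {fset int}) p :
    (forall i, F i 0 = 0) -> (msupp p `<=` d)%fset ->
  \sum_(i <- msupp p) F i p@_i = \sum_(i <- d) F i p@_i.
Proof.
move=> F0 le_d; apply: (big_fset_incl _ le_d) => i _ /mcoeff_outdom ->.
exact: F0.
Qed.

Lemma laurent_sumD (F : int -> R -> laurent R) p q :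
    (forall i, F i 0 = 0) -> (forall i, {morph F i : c d / c + d}) ->
  \sum_(i <- msupp (p + q)) F i (p + q)@_i =
  \sum_(i <- msupp p) F i p@_i + \sum_(i <- msupp q) F i q@_i.
Proof.
move=> F0 FD; rewrite (laurent_sum_incl F0 (msuppD_le p q)).
rewrite (laurent_sum_incl F0 (fsubsetUl (msupp p) (msupp q))).
rewrite (laurent_sum_incl F0 (fsubsetUr (msupp p) (msupp q))).
rewrite -big_split /=; apply: eq_bigr => i _.
by rewrite mcoeffD FD.
Qed.

Lemma laurent_sumM (F : int -> R -> laurent R) c i :
    (forall i, F i 0 = 0) ->
  \sum_(j <- msupp (laurentM c i)) F j (laurentM c i)@_j = F i c.
Proof.
move=> F0; rewrite (laurent_sum_incl F0 (@msuppU_le _ _ i c)).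
by rewrite big_seq_fset1 mcoeffUU.
Qed.

Lemma laurent_mulC : commutative laurent_mul.
Proof.
move=> p q; rewrite /laurent_mul exchange_big /=.
by apply: eq_bigr => j _; apply: eq_bigr => i _; rewrite mulrC addrC.
Qed.

Lemma laurent_mulDl : left_distributive laurent_mul +%R.
Proof.
move=> p q r; rewrite /laurent_mul.
apply: (@laurent_sumD
  (fun i c => \sum_(j <- msupp r) laurentM (c * r@_j) (i + j))).
  by move=> i; rewrite big1 // => j _; rewrite mul0r laurentM0.
move=> i c d; rewrite -big_split; apply: eq_bigr => j _.
by rewrite /= mulrDl laurentMD.
Qed.

Lemma laurent_mulDr : right_distributive laurent_mul +%R.
Proof. by move=> p q r; rewrite !(laurent_mulC p) laurent_mulDl. Qed.

Lemma laurent_mul0 p : laurent_mul 0 p = 0.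
Proof. by rewrite /laurent_mul msupp0 big_seq_fset0. Qed.

Lemma laurent_mulMM c d i j :
  laurent_mul (laurentM c i) (laurentM d j) = laurentM (c * d) (i + j).
Proof.
rewrite /laurent_mul (@laurent_sumM
  (fun i c => \sum_(k <- msupp (laurentM d j))
     laurentM (c * (laurentM d j)@_k) (i + k))); last first.
  by move=> k; rewrite big1 // => l _; rewrite mul0r laurentM0.
rewrite (@laurent_sumM (fun k e => laurentM (c * e) (i + k))) //.
by move=> k; rewrite mulr0 laurentM0.
Qed.

Lemma laurent_ind (P : laurent R -> Prop) :
    P 0 -> (forall p q, P p -> P q -> P (p + q)) ->
    (forall c i, P (laurentM c i)) -> forall p, P p.
Proof.
move=> P0 PD PM p; rewrite (laurentE p).
by elim/big_ind: _ => // i _; apply: PM.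
Qed.

Lemma laurent_mulA : associative laurent_mul.
Proof.
have mul0 p : laurent_mul p 0 = 0 by rewrite laurent_mulC laurent_mul0.
move=> p q r; elim/laurent_ind: p => [|p p' IH IH'|c i].
- by rewrite !laurent_mul0.
- by rewrite !laurent_mulDl IH IH'.
elim/laurent_ind: q => [|q q' IH IH'|d j].
- by rewrite !(mul0, laurent_mul0).
- by rewrite !(laurent_mulDl, laurent_mulDr) IH IH'.
elim/laurent_ind: r => [|r r' IH IH'|e k].
- by rewrite !mul0.
- by rewrite !laurent_mulDr IH IH'.
by rewrite !laurent_mulMM mulrA addrA.
Qed.

Lemma laurent_mul1 : left_id (laurentM 1 0) laurent_mul.
Proof.
elim/laurent_ind => [|p q IH IH'|c i].
- by rewrite laurent_mulC laurent_mul0.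
- by rewrite laurent_mulDr IH IH'.
by rewrite laurent_mulMM mul1r add0r.
Qed.

Lemma laurent1_neq0 : laurentM 1 0 != 0.
Proof. by rewrite /laurentM (@monalgU_eq0 int R 1 0) oner_eq0. Qed.

HB.instance Definition _ := GRing.Zmodule_isComNzRing.Build (laurent R)
  laurent_mulA laurent_mulC laurent_mul1 laurent_mulDl laurent1_neq0.

Lemma laurentZM c d i : c *: laurentM d i = laurentM (c * d) i.
Proof. by apply/malgP => j; rewrite mcoeffZ !mcoeffU mulrnAr. Qed.

Lemma laurent_scaleAl c p q : c *: (p * q) = (c *: p) * q.
Proof.
elim/laurent_ind: p => [|p p' IH IH'|d i].
- by rewrite !(mul0r, scaler0).
- by rewrite !(mulrDl, scalerDr) IH IH'.
elim/laurent_ind: q => [|q q' IH IH'|e j].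
- by rewrite !(mulr0, scaler0).
- by rewrite !mulrDr scalerDr IH IH'.
have mulMM (a b : R) k l : laurentM a k * laurentM b l = laurentM (a * b) (k + l).
  exact: laurent_mulMM.
by rewrite laurentZM !mulMM laurentZM mulrA.
Qed.

HB.instance Definition _ :=
  GRing.Lmodule_isLalgebra.Build R (laurent R) laurent_scaleAl.
HB.instance Definition _ := GRing.Lalgebra_isComAlgebra.Build R (laurent R).

Lemma laurentMM c d i j :
  laurentM c i * laurentM d j = laurentM (c * d) (i + j).
Proof. exact: laurent_mulMM. Qed.

Lemma laurent1E : 1 = laurentM 1 0 :> laurent R.
Proof. by []. Qed.

Definition laurentX (i : int) : laurent R := laurentM 1 i.

Lemma laurentX0 : laurentX 0 = 1.
Proof. by []. Qed.

Lemma laurentXD i j : laurentX (i + j) = laurentX i * laurentX j.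
Proof. by rewrite laurentMM mulr1. Qed.

Lemma laurentMX c i : laurentM c i = c *: laurentX i.
Proof. by rewrite laurentZM mulr1. Qed.

End Laurent.


Record algAut (k : nzRingType) (R : algType k) := AlgAut {
  aut_fun :> {lrmorphism R -> R};
  aut_inv : R -> R;
  aut_funK : cancel aut_fun aut_inv;
  aut_invK : cancel aut_inv aut_fun }.

Section Center.
Variables (k : comNzRingType) (A : algType k).

Definition in_center : {pred A} := fun z => `[< forall a, z * a = a * z >].

Lemma in_centerP z : reflect (forall a, z * a = a * z) (z \in in_center).
Proof. exact: asboolP. Qed.

Fact in_center_subalg : subalg_closed in_center.
Proof.
split=> [|c u v /in_centerP uC /in_centerP vC|u v /in_centerP uC /in_centerP vC];
  apply/in_centerP => a.
- by rewrite mulr1 mul1r.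
- by rewrite mulrDl mulrDr vC -scalerAl -scalerAr uC.
- by rewrite -mulrA vC mulrA uC mulrA.
Qed.

HB.instance Definition _ := GRing.isSubalgClosed.Build k A in_center
  in_center_subalg.

Record center := Center { center_val :> A; _ : center_val \in in_center }.

HB.instance Definition _ := [isSub for center_val].
HB.instance Definition _ := [Choice of center by <:].
HB.instance Definition _ := [SubChoice_isSubAlgebra of center by <:].

Fact center_mulC : commutative (@GRing.mul center).
Proof.
by move=> [u uC] v; apply: val_inj; rewrite !rmorphM; apply/in_centerP.
Qed.

HB.instance Definition _ := GRing.PzRing_hasCommutativeMul.Build center
  center_mulC.

End Center.

Section LaurentInv.
Variable R : comNzRingType.

Definition laurent_flip (p : laurent R) : laurent R :=
  \sum_(i <- msupp p) p@_i *: laurentX R (- i).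

Fact laurent_flipD : {morph laurent_flip : p q / p + q}.
Proof.
move=> p q; apply: (@laurent_sumD R (fun i c => c *: laurentX R (- i))).
  by move=> i; rewrite scale0r.
by move=> i c d; rewrite scalerDl.
Qed.

Lemma laurent_flipM c i : laurent_flip (laurentM c i) = laurentM c (- i).
Proof.
rewrite [RHS]laurentMX.
apply: (@laurent_sumM R (fun i c => c *: laurentX R (- i))).
by move=> j; rewrite scale0r.
Qed.

Lemma laurent_flip0 : laurent_flip 0 = 0.
Proof. by rewrite /laurent_flip msupp0 big_seq_fset0. Qed.

Lemma laurent_flipX i : laurent_flip (laurentX R i) = laurentX R (- i).
Proof. exact: laurent_flipM. Qed.

Fact laurent_flipZ c : {morph laurent_flip : p / c *: p}.
Proof.
elim/laurent_ind => [|p q IH IH'|d i].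
- by rewrite scaler0 laurent_flip0 scaler0.
- by rewrite scalerDr !laurent_flipD scalerDr IH IH'.
by rewrite laurentZM !laurent_flipM laurentZM.
Qed.

Fact laurent_flip_mul : {morph laurent_flip : p q / p * q}.
Proof.
move=> p q; elim/laurent_ind: p => [|p p' IH IH'|c i].
- by rewrite mul0r laurent_flip0 mul0r.
- by rewrite mulrDl !laurent_flipD mulrDl IH IH'.
elim/laurent_ind: q => [|q q' IH IH'|d j].
- by rewrite mulr0 laurent_flip0 mulr0.
- by rewrite mulrDr !laurent_flipD mulrDr IH IH'.
by rewrite laurentMM !laurent_flipM laurentMM opprD.
Qed.

Fact laurent_flip1 : laurent_flip 1 = 1.
Proof. by rewrite laurent1E laurent_flipM oppr0. Qed.

Fact laurent_flip_linear : linear laurent_flip.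
Proof. by move=> c p q; rewrite laurent_flipD laurent_flipZ. Qed.

HB.instance Definition _ := GRing.isLinear.Build R (laurent R) (laurent R) _
  laurent_flip laurent_flip_linear.
HB.instance Definition _ := GRing.isMonoidMorphism.Build (laurent R) (laurent R)
  laurent_flip (laurent_flip1, laurent_flip_mul).

Fact laurent_flipK : involutive laurent_flip.
Proof.
elim/laurent_ind => [|p q IH IH'|c i]; first by rewrite !laurent_flip0.
  by rewrite !laurent_flipD IH IH'.
by rewrite !laurent_flipM opprK.
Qed.

Definition sigma_inv : algAut (laurent R) :=
  AlgAut laurent_flipK laurent_flipK.

Lemma sigma_invX : sigma_inv (laurentX R 1) = laurentX R (-1).
Proof. exact: laurent_flipX. Qed.

End LaurentInv.

Inductive gwa_term (R : Type) : Type :=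
  | GConst of R
  | GX
  | GY
  | GAdd of gwa_term R & gwa_term R
  | GMul of gwa_term R & gwa_term R.

Arguments GX {R}.
Arguments GY {R}.

HB.instance Definition _ (R : Type) := gen_eqMixin (gwa_term R).
HB.instance Definition _ (R : Type) := gen_choiceMixin (gwa_term R).

Section GWA.
Variables (k : fieldType) (R : algType k) (sigma : algAut R) (a : center R).

Local Notation term := (gwa_term R).
Implicit Types (s t u : term) (r : R) (c : k).

(* The least congruence making the terms a k-algebra extension of [R] in which
   the defining relations of the generalized Weyl algebra hold. *)
Inductive gwa_rel : term -> term -> Prop :=
  | rel_refl s : gwa_rel s s
  | rel_sym s t : gwa_rel s t -> gwa_rel t s
  | rel_trans s t u : gwa_rel s t -> gwa_rel t u -> gwa_rel s u
  | rel_congD s s' t t' :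
      gwa_rel s s' -> gwa_rel t t' -> gwa_rel (GAdd s t) (GAdd s' t')
  | rel_congM s s' t t' :
      gwa_rel s s' -> gwa_rel t t' -> gwa_rel (GMul s t) (GMul s' t')
  | rel_addA s t u : gwa_rel (GAdd s (GAdd t u)) (GAdd (GAdd s t) u)
  | rel_addC s t : gwa_rel (GAdd s t) (GAdd t s)
  | rel_add0 s : gwa_rel (GAdd (GConst 0) s) s
  | rel_addN s : gwa_rel (GAdd (GMul (GConst (-1)) s) s) (GConst 0)
  | rel_mulA s t u : gwa_rel (GMul s (GMul t u)) (GMul (GMul s t) u)
  | rel_mul1l s : gwa_rel (GMul (GConst 1) s) s
  | rel_mul1r s : gwa_rel (GMul s (GConst 1)) s
  | rel_mulDl s t u :
      gwa_rel (GMul (GAdd s t) u) (GAdd (GMul s u) (GMul t u))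
  | rel_mulDr s t u :
      gwa_rel (GMul s (GAdd t u)) (GAdd (GMul s t) (GMul s u))
  | rel_scalC c s : gwa_rel (GMul (GConst c%:A) s) (GMul s (GConst c%:A))
  | rel_constD r r' : gwa_rel (GConst (r + r')) (GAdd (GConst r) (GConst r'))
  | rel_constM r r' : gwa_rel (GConst (r * r')) (GMul (GConst r) (GConst r'))
  | rel_YX : gwa_rel (GMul GY GX) (GConst (val a))
  | rel_XY : gwa_rel (GMul GX GY) (GConst (sigma (val a)))
  | rel_X r : gwa_rel (GMul GX (GConst r)) (GMul (GConst (sigma r)) GX)
  | rel_Y r :
      gwa_rel (GMul GY (GConst r)) (GMul (GConst (aut_inv sigma r)) GY).

Definition gwa_eqb s t : bool := `[< gwa_rel s t >].

Fact gwa_eqb_equiv : equiv_class_of gwa_eqb.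
Proof.
split=> [s|s t|t s u]; first by apply/asboolP/rel_refl.
  by apply/asboolP/asboolP => /rel_sym.
by move=> /asboolP st /asboolP tu; apply/asboolP/(rel_trans st).
Qed.

Canonical gwa_equiv := EquivRelPack gwa_eqb_equiv.

Definition gwa : Type := {eq_quot gwa_equiv}.

HB.instance Definition _ := Choice.on gwa.

Definition gwa_pi (s : term) : gwa := \pi_({eq_quot gwa_equiv}) s.

Definition gwa_repr (z : gwa) : term := repr (z : {eq_quot gwa_equiv}).

Lemma gwa_piP s t : gwa_pi s = gwa_pi t <-> gwa_rel s t.
Proof.
by split=> [/eqmodP/asboolP | st] //; apply/eqmodP/asboolP.
Qed.

Lemma gwa_reprK : cancel gwa_repr gwa_pi.
Proof. exact: reprK. Qed.

Lemma gwa_reprP s : gwa_rel (gwa_repr (gwa_pi s)) s.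
Proof. by apply/gwa_piP; rewrite gwa_reprK. Qed.

Definition gwa_add (z w : gwa) := gwa_pi (GAdd (gwa_repr z) (gwa_repr w)).
Definition gwa_mul (z w : gwa) := gwa_pi (GMul (gwa_repr z) (gwa_repr w)).
Definition gwa_const_fun (r : R) : gwa := gwa_pi (GConst r).
Definition gwa_opp (z : gwa) := gwa_mul (gwa_const_fun (-1)) z.
Definition gwa_scale (c : k) (z : gwa) := gwa_mul (gwa_const_fun c%:A) z.

Lemma gwa_piD s t : gwa_pi (GAdd s t) = gwa_add (gwa_pi s) (gwa_pi t).
Proof. by apply/gwa_piP/rel_congD; apply/rel_sym/gwa_reprP. Qed.

Lemma gwa_piM s t : gwa_pi (GMul s t) = gwa_mul (gwa_pi s) (gwa_pi t).
Proof. by apply/gwa_piP/rel_congM; apply/rel_sym/gwa_reprP. Qed.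

Lemma gwa_piW (P : gwa -> Prop) : (forall t, P (gwa_pi t)) -> forall z, P z.
Proof. by move=> Ppi z; rewrite -(gwa_reprK z). Qed.

Fact gwa_addrA : associative gwa_add.
Proof. by do 3!elim/gwa_piW=> ?; rewrite -!gwa_piD; apply/gwa_piP/rel_addA. Qed.

Fact gwa_addrC : commutative gwa_add.
Proof. by do 2!elim/gwa_piW=> ?; rewrite -!gwa_piD; apply/gwa_piP/rel_addC. Qed.

Fact gwa_add0r : left_id (gwa_const_fun 0) gwa_add.
Proof. by elim/gwa_piW=> ?; rewrite -!gwa_piD; apply/gwa_piP/rel_add0. Qed.

Fact gwa_addNr : left_inverse (gwa_const_fun 0) gwa_opp gwa_add.
Proof. by elim/gwa_piW=> ?; rewrite /gwa_opp -gwa_piM -gwa_piD; apply/gwa_piP/rel_addN. Qed.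

HB.instance Definition _ :=
  GRing.isZmodule.Build gwa gwa_addrA gwa_addrC gwa_add0r gwa_addNr.

Fact gwa_mulrA : associative gwa_mul.
Proof. by do 3!elim/gwa_piW=> ?; rewrite -!gwa_piM; apply/gwa_piP/rel_mulA. Qed.

Fact gwa_mul1r : left_id (gwa_const_fun 1) gwa_mul.
Proof. by elim/gwa_piW=> ?; rewrite -!gwa_piM; apply/gwa_piP/rel_mul1l. Qed.

Fact gwa_mulr1 : right_id (gwa_const_fun 1) gwa_mul.
Proof. by elim/gwa_piW=> ?; rewrite -!gwa_piM; apply/gwa_piP/rel_mul1r. Qed.

Fact gwa_mulrDl : left_distributive gwa_mul gwa_add.
Proof.
by do 3!elim/gwa_piW=> ?; rewrite -gwa_piD -!gwa_piM -gwa_piD; apply/gwa_piP/rel_mulDl.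
Qed.

Fact gwa_mulrDr : right_distributive gwa_mul gwa_add.
Proof.
by do 3!elim/gwa_piW=> ?; rewrite -gwa_piD -!gwa_piM -gwa_piD; apply/gwa_piP/rel_mulDr.
Qed.

(* The algebra acts on the functions [int -> R], hence is not trivial; [algType]
   requires this. *)
Definition aut_pow (i : int) : R -> R :=
  match i with
  | Posz n => iter n sigma
  | Negz n => iter n.+1 (aut_inv sigma)
  end.

Fact aut_powS i r : aut_pow (i + 1) r = aut_pow i (sigma r).
Proof.
case: i => [n|[|n]].
- by rewrite -PoszD addn1 /= -iterSr.
- by rewrite /= aut_funK.
have -> : Negz n.+1 + 1 = Negz n by rewrite !NegzE -addn1 PoszD opprD addrNK.
by rewrite /aut_pow [iter n.+2 _ _]iterSr aut_funK.
Qed.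

Fact aut_invD : {morph aut_inv sigma : r s / r + s}.
Proof.
move=> r s; apply: (can_inj (aut_funK sigma)).
by rewrite rmorphD /= !aut_invK.
Qed.

Fact aut_invM : {morph aut_inv sigma : r s / r * s}.
Proof.
move=> r s; apply: (can_inj (aut_funK sigma)).
by rewrite rmorphM /= !aut_invK.
Qed.

Fact aut_invA c : aut_inv sigma c%:A = c%:A.
Proof.
by apply: (can_inj (aut_funK sigma)); rewrite aut_invK linearZ rmorph1.
Qed.

Fact aut_powD i : {morph aut_pow i : r s / r + s}.
Proof.
case: i => n r s; rewrite /aut_pow; elim: n => [|n IH] //=.
- by rewrite IH rmorphD.
- by rewrite aut_invD.
by rewrite [LHS](congr1 (aut_inv sigma) IH) aut_invD.
Qed.

Fact aut_powM i : {morph aut_pow i : r s / r * s}.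
Proof.
case: i => n r s; rewrite /aut_pow; elim: n => [|n IH] //=.
- by rewrite IH rmorphM.
- by rewrite aut_invM.
by rewrite [LHS](congr1 (aut_inv sigma) IH) aut_invM.
Qed.

Fact aut_powA i c : aut_pow i c%:A = c%:A.
Proof.
case: i => n; rewrite /aut_pow; elim: n => [|n IH] //=.
- by rewrite IH linearZ rmorph1.
- by rewrite aut_invA.
by rewrite [LHS](congr1 (aut_inv sigma) IH) aut_invA.
Qed.

Fact aut_pow0 i : aut_pow i 0 = 0.
Proof. by rewrite -(scale0r (1 : R)) aut_powA. Qed.

Fact aut_pow1 i : aut_pow i 1 = 1.
Proof. by rewrite -(scale1r (1 : R)) aut_powA. Qed.

Fixpoint gwa_act (t : term) (f : int -> R) (i : int) : R :=
  match t with
  | GConst r => aut_pow i r * f i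
  | GX => f (i + 1)
  | GY => aut_pow i (val a) * f (i - 1)
  | GAdd s t => gwa_act s f i + gwa_act t f i
  | GMul s t => gwa_act s (gwa_act t f) i
  end.

Fact gwa_act_ext t f g i : f =1 g -> gwa_act t f i = gwa_act t g i.
Proof. by move=> /funext ->. Qed.

Fact gwa_actD t f g i :
  gwa_act t (fun j => f j + g j) i = gwa_act t f i + gwa_act t g i.
Proof.
elim: t f g i => [r|||s IHs t IHt|s IHs t IHt] f g i //=.
- by rewrite mulrDr.
- by rewrite mulrDr.
- by rewrite IHs IHt addrACA.
by rewrite -IHs; apply: gwa_act_ext => j; rewrite IHt.
Qed.

Fact gwa_actZ t c f i :
  gwa_act t (fun j => c *: f j) i = c *: gwa_act t f i.
Proof.
elim: t f i => [r|||s IHs t IHt|s IHs t IHt] f i //=.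
- by rewrite scalerAr.
- by rewrite scalerAr.
- by rewrite IHs IHt scalerDr.
by rewrite -IHs; apply: gwa_act_ext => j; rewrite IHt.
Qed.

Fact gwa_act_rel s t : gwa_rel s t -> gwa_act s =2 gwa_act t.
Proof.
have aC i r : aut_pow i (val a) * aut_pow i r = aut_pow i r * aut_pow i (val a).
  by rewrite -!aut_powM; congr aut_pow; apply/in_centerP/(valP a).
elim=> {s t} //=.
- by move=> s t _ IH f i; rewrite IH.
- by move=> s t u _ IH _ IH' f i; rewrite IH IH'.
- by move=> s s' t t' _ IH _ IH' f i; rewrite IH IH'.
- by move=> s s' t t' _ IH _ IH' f i; rewrite IH; apply: gwa_act_ext => j.
- by move=> s t u f i; rewrite addrA.
- by move=> s t f i; rewrite addrC.
- by move=> s f i; rewrite aut_pow0 mul0r add0r.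
- move=> s f i; rewrite aut_pow0 mul0r -scaleN1r aut_powA.
  by rewrite -scalerAl mul1r scaleN1r addNr.
- by move=> s f i; rewrite aut_pow1 mul1r.
- by move=> s f i; apply: gwa_act_ext => j; rewrite aut_pow1 mul1r.
- by move=> s t u f i; rewrite -gwa_actD.
- move=> c s f i; rewrite aut_powA -scalerAl mul1r -gwa_actZ.
  by apply: gwa_act_ext => j; rewrite aut_powA -scalerAl mul1r.
- by move=> r r' f i; rewrite aut_powD mulrDl.
- by move=> r r' f i; rewrite aut_powM mulrA.
- by move=> f i; rewrite subrK.
- by move=> f i; rewrite aut_powS addrK.
- by move=> r f i; rewrite aut_powS.
move=> r f i; rewrite !mulrA; congr (_ * _).
rewrite -[in aut_pow (i - 1) r](aut_invK sigma r) -aut_powS subrK.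
exact: aC.
Qed.

Fact gwa_oner_neq0 : gwa_const_fun 1 != 0.
Proof.
apply/eqP => /gwa_piP /gwa_act_rel /(_ (fun=> 1) 0) /= /eqP.
by rewrite mul1r mul0r oner_eq0.
Qed.

HB.instance Definition _ := GRing.Zmodule_isNzRing.Build gwa
  gwa_mulrA gwa_mul1r gwa_mulr1 gwa_mulrDl gwa_mulrDr gwa_oner_neq0.

Lemma gwa_const_funD : {morph gwa_const_fun : r s / r + s}.
Proof.
by move=> r s; rewrite -[RHS]gwa_piD; apply/gwa_piP/rel_constD.
Qed.

Lemma gwa_const_funM : {morph gwa_const_fun : r s / r * s}.
Proof.
by move=> r s; rewrite -[RHS]gwa_piM; apply/gwa_piP/rel_constM.
Qed.

Fact gwa_scalerA c d (z : gwa) :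
  gwa_scale c (gwa_scale d z) = gwa_scale (c * d) z.
Proof.
rewrite /gwa_scale [LHS](mulrA (_ : gwa)) -[X in X * _]gwa_const_funM.
by rewrite -scalerAl mul1r scalerA.
Qed.

Fact gwa_scale1r : left_id 1 gwa_scale.
Proof. by move=> z; rewrite /gwa_scale scale1r; apply: gwa_mul1r. Qed.

Fact gwa_scalerDr : right_distributive gwa_scale +%R.
Proof. by move=> c z w; apply: gwa_mulrDr. Qed.

Fact gwa_scalerDl z : {morph gwa_scale^~ z : c d / c + d}.
Proof.
by move=> c d; rewrite /gwa_scale scalerDl gwa_const_funD; apply: gwa_mulrDl.
Qed.

HB.instance Definition _ := GRing.Zmodule_isLmodule.Build k gwa
  gwa_scalerA gwa_scale1r gwa_scalerDr gwa_scalerDl.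

Fact gwa_scalerAl c (z w : gwa) : c *: (z * w) = (c *: z) * w.
Proof. exact: gwa_mulrA. Qed.

HB.instance Definition _ := GRing.Lmodule_isLalgebra.Build k gwa gwa_scalerAl.

Fact gwa_scalerAr c (z w : gwa) : c *: (z * w) = z * (c *: w).
Proof.
have scalC (v : gwa) : gwa_const_fun c%:A * v = v * gwa_const_fun c%:A.
  rewrite -(gwa_reprK v) -[LHS]gwa_piM -[RHS]gwa_piM.
  exact/gwa_piP/rel_scalC.
by rewrite [LHS](mulrA (_ : gwa)) scalC -mulrA.
Qed.

HB.instance Definition _ := GRing.Lalgebra_isAlgebra.Build k gwa gwa_scalerAr.

Definition gwa_const (r : R) : gwa := gwa_const_fun r.
Definition gwa_x : gwa := gwa_pi GX.
Definition gwa_y : gwa := gwa_pi GY.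

Fact gwa_const_linear : linear gwa_const.
Proof.
move=> c r s; rewrite /gwa_const gwa_const_funD; congr (_ + _).
by rewrite -{1}(mul1r r) scalerAl gwa_const_funM.
Qed.

Fact gwa_const_multiplicative : monoid_morphism gwa_const.
Proof. by split=> // r s; apply: gwa_const_funM. Qed.

HB.instance Definition _ := GRing.isLinear.Build k R gwa _ gwa_const
  gwa_const_linear.
HB.instance Definition _ := GRing.isMonoidMorphism.Build R gwa gwa_const
  gwa_const_multiplicative.

Lemma gwa_yx : gwa_y * gwa_x = gwa_const (val a).
Proof. by rewrite -[LHS]gwa_piM; apply/gwa_piP/rel_YX. Qed.

Lemma gwa_xy : gwa_x * gwa_y = gwa_const (sigma (val a)).
Proof. by rewrite -[LHS]gwa_piM; apply/gwa_piP/rel_XY. Qed.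

Lemma gwa_x_const r : gwa_x * gwa_const r = gwa_const (sigma r) * gwa_x.
Proof. by rewrite -[LHS]gwa_piM -[RHS]gwa_piM; apply/gwa_piP/rel_X. Qed.

Lemma gwa_y_const r :
  gwa_y * gwa_const r = gwa_const (aut_inv sigma r) * gwa_y.
Proof. by rewrite -[LHS]gwa_piM -[RHS]gwa_piM; apply/gwa_piP/rel_Y. Qed.

Lemma gwa_universal (B : algType k) (phi : {lrmorphism R -> B}) (x y : B) :
    y * x = phi (val a) -> x * y = phi (sigma (val a)) ->
    (forall r, x * phi r = phi (sigma r) * x) ->
    (forall r, y * phi r = phi (aut_inv sigma r) * y) ->
  exists! f : gwa -> B,
    [/\ linear f /\ monoid_morphism f, forall r, f (gwa_const r) = phi r,
        f gwa_x = x & f gwa_y = y].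
Proof.
move=> yx xy xr yr.
pose ev := fix ev (t : term) : B :=
  match t with
  | GConst r => phi r | GX => x | GY => y
  | GAdd s t => ev s + ev t | GMul s t => ev s * ev t
  end.
have phiA c : phi c%:A = c%:A by rewrite linearZ rmorph1.
have ev_rel s t : gwa_rel s t -> ev s = ev t.
  elim=> {s t} //=; try by move=> *; congruence.
  - by move=> s t u; rewrite addrA.
  - by move=> s t; rewrite addrC.
  - by move=> s; rewrite rmorph0 add0r.
  - by move=> s; rewrite rmorphN1 rmorph0 mulN1r addNr.
  - by move=> s t u; rewrite mulrA.
  - by move=> s; rewrite rmorph1 mul1r.
  - by move=> s; rewrite rmorph1 mulr1.
  - by move=> s t u; rewrite mulrDl.
  - by move=> s t u; rewrite mulrDr.
  - by move=> c s; rewrite phiA -scalerAl -scalerAr mul1r mulr1.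
  - by move=> r r'; rewrite rmorphD.
  - by move=> r r'; rewrite rmorphM.
pose f (z : gwa) := ev (gwa_repr z).
have fpi t : f (gwa_pi t) = ev t by apply/ev_rel/gwa_reprP.
have fD z w : f (z + w) = f z + f w by rewrite [LHS]fpi.
have fM z w : f (z * w) = f z * f w by rewrite [LHS]fpi.
exists f; split.
  split; try by move=> *; apply: fpi.
  split; last by split; [rewrite [LHS]fpi /= rmorph1|].
  by move=> c z w; rewrite fD [f (c *: z)]fM fpi /= phiA -scalerAl mul1r.
move=> g [[glin [g1 gM]] gr gx gy].
have gD z w : g (z + w) = g z + g w by have := glin 1 z w; rewrite !scale1r.
apply/funext => z; rewrite -(gwa_reprK z) fpi.
elim: (gwa_repr z) => [r|||s IHs t IHt|s IHs t IHt] /=.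
- by rewrite -gr.
- by rewrite -gx.
- by rewrite -gy.
- by rewrite gwa_piD [RHS]gD IHs IHt.
by rewrite gwa_piM [RHS]gM IHs IHt.
Qed.

End GWA.

Arguments gwa {k R} sigma a.
Arguments gwa_const {k R} sigma a r.
Arguments gwa_x {k R} sigma a.
Arguments gwa_y {k R} sigma a.

(* Main.v *)
(* Since [y = x^-1], every element of the algebra is uniquely a finite sum
   [\sum_i r_i x^i] with [r_i] a Laurent polynomial. Commuting with [h] means
   [r_i sigma^i(h) = h r_i] for all [i], which forces [r_i = 0] for odd [i];
   commuting with [x] means that each [r_i] is invariant under [h <-> h^-1],
   that is, a polynomial in [h + h^-1]. *)
Require Import Defs.
From HB Require Import structures.
From mathcomp Require Import all_boot all_order all_algebra.
From mathcomp Require Import finmap boolp.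
From mathcomp.multinomials Require Import monalg.
From mathcomp Require Import zify.

Set Implicit Arguments.
Unset Strict Implicit.
Unset Printing Implicit Defensive.

Import GRing.Theory Num.Theory.
Local Open Scope ring_scope.

Lemma addr1_eq (i j : int) : (i + 1 == j + 1) = (i == j).
Proof. exact: (inj_eq (addIr 1)). Qed.

(** * Normal form and center criteria in [R(sigma, 1)], for any [R] and [sigma] *)

Section GwaOne.
Variables (k : fieldType) (R : algType k) (sigma : algAut R).

Local Notation A := (gwa sigma 1).
Local Notation const := (gwa_const sigma 1).
Local Notation x := (gwa_x sigma 1).
Local Notation y := (gwa_y sigma 1).
Local Notation repr := (@gwa_repr k R sigma 1).
Local Notation act := (gwa_act sigma 1).
Implicit Types (z w : A) (r : R) (i j m : int).

(** The integer power [x^i]: for [a = 1] the generator [y] is the inverse of [x]. *)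
Definition gwa_Xz i : A :=
  match i with Posz n => x ^+ n | Negz n => y ^+ n.+1 end.

Lemma gwa_one_yx : y * x = 1.
Proof. by rewrite gwa_yx rmorph1. Qed.

Lemma gwa_one_xy : x * y = 1.
Proof. by rewrite gwa_xy !rmorph1. Qed.

Lemma gwa_XzSr i : gwa_Xz (i + 1) = gwa_Xz i * x.
Proof.
case: i => [n|[|n]]; first by rewrite -PoszD addn1 [LHS]exprSr.
  by rewrite [RHS]gwa_one_yx.
have -> : Negz n.+1 + 1 = Negz n by lia.
by rewrite [gwa_Xz (Negz n.+1)]exprSr -mulrA gwa_one_yx mulr1.
Qed.

Lemma gwa_XzBr i : gwa_Xz (i - 1) = gwa_Xz i * y.
Proof. by rewrite -{2}[i](subrK 1) gwa_XzSr -mulrA gwa_one_xy mulr1. Qed.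

Lemma gwa_XzD i j : gwa_Xz (i + j) = gwa_Xz i * gwa_Xz j.
Proof.
elim/int_rect: j => [|n IH|n IH]; first by rewrite addr0 mulr1.
  by rewrite intS [1 + _]addrC addrA !gwa_XzSr IH mulrA.
by rewrite intS opprD [-1 - _]addrC addrA !gwa_XzBr IH mulrA.
Qed.

Lemma gwa_Xz_const i r : gwa_Xz i * const r = const (aut_pow sigma i r) * gwa_Xz i.
Proof.
have invS j s : aut_pow sigma (j - 1) s = aut_pow sigma j (aut_inv sigma s).
  by rewrite -{2}[j](subrK 1) aut_powS aut_invK.
elim/int_rect: i r => [|n IH|n IH] r.
- by rewrite /= expr0 mul1r mulr1.
- rewrite intS [1 + _]addrC aut_powS !gwa_XzSr -mulrA gwa_x_const.
  by rewrite mulrA IH mulrA.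
rewrite intS opprD [-1 - _]addrC invS !gwa_XzBr -mulrA gwa_y_const.
by rewrite mulrA IH mulrA.
Qed.

(** The finite sums of monomials [r x^i] contain 1 and are stable under right multiplication by the
    generators, hence by every term. *)
Lemma gwa_expansion z : exists p : {malg R[int]}, z = mmap const gwa_Xz p.
Proof.
pose Q z := exists p : {malg R[int]}, z = mmap const gwa_Xz p.
have QD z1 z2 : Q z1 -> Q z2 -> Q (z1 + z2).
  by move=> [p1 ->] [p2 ->]; exists (p1 + p2); rewrite raddfD.
have QM r i : Q (const r * gwa_Xz i) by exists (mkmalgU i r); rewrite mmapU.
have Qsum (p : {malg R[int]}) t :
    (forall r i, Q (const r * gwa_Xz i * t)) -> Q (mmap const gwa_Xz p * t).
  move=> Qt; rewrite mmapE mulr_suml; elim/big_ind: _ => //.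
  by exists 0; rewrite raddf0.
(* Quantifying over the left factor lets the product case multiply by [s] first, then by [t]. *)
suff Qmul t : forall z, Q z -> Q (z * gwa_pi sigma 1 t).
  elim/gwa_piW: z => t; rewrite -[gwa_pi _ _ _]mul1r; apply: Qmul.
  by have := QM 1 0; rewrite rmorph1 mul1r.
elim: t => [s|||s IHs t IHt|s IHs t IHt] _ [p ->].
- apply: Qsum => r i; rewrite -mulrA [gwa_Xz i * _]gwa_Xz_const mulrA -rmorphM.
  exact: QM.
- by apply: Qsum => r i; rewrite -mulrA -gwa_XzSr.
- by apply: Qsum => r i; rewrite -mulrA -gwa_XzBr.
- rewrite gwa_piD mulrDr; apply: QD; [apply: IHs|apply: IHt]; by exists p.
by rewrite gwa_piM mulrA; apply/IHt/IHs; exists p.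
Qed.

Lemma gwa_monomial_ind (P : A -> Prop) :
    (forall z w, P z -> P w -> P (z + w)) ->
    (forall r i, P (const r * gwa_Xz i)) -> forall z, P z.
Proof.
move=> PD PM z; have [p ->] := gwa_expansion z.
rewrite mmapE; elim/big_ind: _ => //.
by have := PM 0 0; rewrite rmorph0 mul0r.
Qed.

(* The coefficient of [x^m], read off the action of [gwa] on functions
   [int -> R]: [r * x^i] maps [f] to a function whose value at [0]
   is [r * f i]. *)
Definition gwa_coef m z : R :=
  act (repr z) (fun i => (i == m)%:R) 0.

Lemma gwa_act_repr z t f i : z = gwa_pi sigma 1 t ->
  act (repr z) f i = act t f i.
Proof. by move=> ->; apply/gwa_act_rel/gwa_reprP. Qed.

Lemma gwa_coef_is_additive m : zmod_morphism (gwa_coef m).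
Proof.
have coefD z w : gwa_coef m (z + w) = gwa_coef m z + gwa_coef m w.
  by rewrite /gwa_coef (gwa_act_repr _ _ (erefl (z + w))).
by move=> z w; apply/eqP; rewrite eq_sym subr_eq -coefD subrK.
Qed.

HB.instance Definition _ m :=
  GRing.isZmodMorphism.Build A R (gwa_coef m) (gwa_coef_is_additive m).

(** Evaluation at index 0 is what makes this hold untwisted: [aut_pow sigma 0] is the identity. *)
Lemma gwa_coef_const r z m : gwa_coef m (const r * z) = r * gwa_coef m z.
Proof.
rewrite /gwa_coef -{1}(gwa_reprK z).
by rewrite (@gwa_act_repr _ (GMul (GConst r) (repr z))) // gwa_piM.
Qed.

Lemma gwa_act_Xz i f j : act (repr (gwa_Xz i)) f j = f (j + i).
Proof.
have actM z w g l : act (repr (z * w)) g l =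
    act (repr z) (act (repr w) g) l.
  by rewrite (@gwa_act_repr _ (GMul (repr z) (repr w))).
elim/int_rect: i j f => [|n IH|n IH] j f.
- by rewrite (@gwa_act_repr _ (GConst 1)) //= aut_pow1 mul1r addr0.
- rewrite intS [1 + _]addrC gwa_XzSr actM IH.
  by rewrite (@gwa_act_repr _ GX) //= addrA.
rewrite intS opprD [-1 - _]addrC gwa_XzBr actM IH (@gwa_act_repr _ GY) //=.
by rewrite aut_pow1 mul1r addrA.
Qed.

Lemma gwa_coef_monomial r i m :
  gwa_coef m (const r * gwa_Xz i) = r *+ (i == m).
Proof.
by rewrite gwa_coef_const /gwa_coef gwa_act_Xz add0r mulr_natr.
Qed.

(** This gives uniqueness of the expansion. *)
Lemma gwa_coef_mmap (p : {malg R[int]}) m :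
  gwa_coef m (mmap const gwa_Xz p) = p@_m.
Proof.
rewrite mmapE raddf_sum /= [in RHS](monalgE p) raddf_sum; apply: eq_bigr => i _.
by rewrite gwa_coef_monomial /= mcoeffU.
Qed.

Lemma gwa_coef_mulr_const z r m :
  gwa_coef m (z * const r) = gwa_coef m z * aut_pow sigma m r.
Proof.
elim/gwa_monomial_ind: z => [z w IHz IHw|s i].
  by rewrite mulrDl !raddfD /= mulrDl IHz IHw.
rewrite -mulrA gwa_Xz_const mulrA -rmorphM !gwa_coef_monomial mulrnAl.
by case: eqP => // ->.
Qed.

Lemma gwa_coef_mulx z m : gwa_coef (m + 1) (z * x) = gwa_coef m z.
Proof.
elim/gwa_monomial_ind: z => [z w IHz IHw|s i].
  by rewrite mulrDl !raddfD /= IHz IHw.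
by rewrite -mulrA -gwa_XzSr !gwa_coef_monomial addr1_eq.
Qed.

Lemma gwa_coef_xmul z m : gwa_coef (m + 1) (x * z) = sigma (gwa_coef m z).
Proof.
elim/gwa_monomial_ind: z => [z w IHz IHw|s i].
  by rewrite mulrDr !raddfD /= IHz IHw.
rewrite mulrA gwa_x_const -mulrA -[x]expr1 -[x ^+ 1]/(gwa_Xz 1) -gwa_XzD.
by rewrite [1 + i]addrC !gwa_coef_monomial addr1_eq rmorphMn.
Qed.

(** Commuting with the generators suffices, and [y], being the inverse of [x], comes for free. *)
Lemma gwa_in_center z :
    (forall r, z * const r = const r * z) -> z * x = x * z ->
  z \in @in_center k A.
Proof.
move=> zC zX; apply/in_centerP; elim/gwa_piW.
have zY : z * y = y * z.
  (* [z y = y x z y = y z x y = y z]. *)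
  rewrite -[LHS]mul1r -gwa_one_yx -!mulrA [x * _]mulrA -zX -!mulrA.
  by rewrite gwa_one_xy mulr1.
elim=> [s|||s IHs t IHt|s IHs t IHt] //.
- exact: zC.
- by rewrite gwa_piD mulrDl mulrDr IHs IHt.
by rewrite gwa_piM mulrA IHs -mulrA IHt mulrA.
Qed.

Lemma gwa_center_coef_const z r m : z \in @in_center k A ->
  gwa_coef m z * aut_pow sigma m r = r * gwa_coef m z.
Proof.
by move=> /in_centerP zC; rewrite -gwa_coef_mulr_const zC gwa_coef_const.
Qed.

Lemma gwa_center_coef_fixed z m : z \in @in_center k A ->
  sigma (gwa_coef m z) = gwa_coef m z.
Proof.
by move=> /in_centerP zC; rewrite -gwa_coef_xmul -zC gwa_coef_mulx.
Qed.

End GwaOne.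

(** * Laurent polynomials fixed by the flip are the polynomials in [h + h^-1] *)

Section FixedRing.
Variable k : fieldType.
Implicit Types (p : laurent k) (q : {poly k}) (c : k) (i j m : int).

Lemma laurent_coefMX p i m : (p * laurentX k i)@_m = p@_(m - i).
Proof.
elim/laurent_ind: p => [|p p' IH IH'|c j]; first by rewrite mul0r !mcoeff0.
  by rewrite mulrDl !mcoeffD IH IH'.
by rewrite laurentMM mulr1 !mcoeffU eq_sym -subr_eq eq_sym.
Qed.

Lemma laurent_coef_eventually0 p :
  exists n : nat, forall m, (n%:Z <= m)%R -> p@_m = 0.
Proof.
(* This bound exceeds every exponent in the support. *)
exists (\sum_(i <- msupp p) `|i|).+1 => m le_nm.
apply/mcoeff_outdom/negP => mp; move: le_nm.
by rewrite (big_fsetD1 m) //=; lia.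
Qed.

Lemma laurent_coef_flip p m : (sigma_inv k p)@_m = p@_(- m).
Proof.
elim/laurent_ind: p => [|p p' IH IH'|c j]; first by rewrite rmorph0 !mcoeff0.
  by rewrite rmorphD !mcoeffD IH IH'.
by rewrite /= laurent_flipM !mcoeffU eqr_oppLR.
Qed.

Definition laurent_trace : laurent k := laurentX k 1 + laurentX k (-1).
Local Notation t := laurent_trace.
Local Notation ht := (horner_alg t).

Lemma laurent_trace_flip : sigma_inv k t = t.
Proof. by rewrite rmorphD /= !laurent_flipX opprK addrC. Qed.

Lemma horner_trace_flip q : sigma_inv k (ht q) = ht q.
Proof.
elim/poly_ind: q => [|q c IH]; first by rewrite !rmorph0.
rewrite rmorphD rmorphM /= horner_algX horner_algC rmorphD rmorphM /=.
by rewrite IH [laurent_flip t]laurent_trace_flip linearZ rmorph1.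
Qed.

(** The top term of [t ^+ n] is [h^n], with coefficient 1; this triangularity drives both
    injectivity and the description of the fixed ring. *)
Lemma laurent_coef_trace_exp n m : (n%:Z <= m)%R -> (t ^+ n)@_m = (m == n)%:R.
Proof.
elim: n m => [|n IH] m le_nm.
  by rewrite expr0 laurent1E mcoeffU eq_sym.
rewrite exprSr mulrDr mcoeffD !laurent_coefMX !IH; try lia.
(* The [h^-1] summand of [t] contributes the coefficient at [m + 1], above the top degree [n]. *)
have -> : (m - -1 == n :> int) = false by lia.
by rewrite addr0; congr (_%:R); lia.
Qed.

Lemma laurent_coef_horner_trace q (n : nat) : (size q <= n.+1)%N ->
  (ht q)@_(n%:Z) = q`_n.
Proof.
move=> le_qn.
have -> : q = \poly_(i < n.+1) q`_i.
  apply/polyP => i; rewrite coef_poly; case: ltnP => // le_ni.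
  by rewrite nth_default // (leq_trans le_qn).
rewrite poly_def rmorph_sum raddf_sum /= coef_sum; apply: eq_bigr => i _.
rewrite -mul_polyC rmorphM /= horner_algC rmorphXn /= horner_algX -scalerAl.
rewrite mul1r mcoeffZ laurent_coef_trace_exp -?mul_polyC ?coefCM ?coefXn //.
by have := ltn_ord i; lia.
Qed.

(** The leading coefficient of [q] reappears as a coefficient of [ht q], so [ht q = 0] forces
    [q = 0]. *)
Lemma horner_trace_inj : injective ht.
Proof.
apply: raddf_inj => q q0; apply/eqP; rewrite -lead_coef_eq0 lead_coefE.
by rewrite -laurent_coef_horner_trace ?leqSpred // q0 mcoeff0.
Qed.

(* The leading term is cancelled by a multiple of [t ^+ n]; by symmetry this
   also cancels the term of lowest degree. *)
Lemma laurent_flip_fixed p : sigma_inv k p = p -> exists q, p = ht q.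
Proof.
move=> p_fix.
have [n] := laurent_coef_eventually0 p.
elim: n p p_fix => [|n IH] p p_fix p0.
  (* Coefficients in degrees at least 0 vanish by [p0], those in negative degrees by symmetry. *)
  exists 0; rewrite rmorph0; apply/malgP => m; rewrite mcoeff0.
  have [|m_lt0] := lerP 0 m; first exact: p0.
  by rewrite -p_fix laurent_coef_flip p0 //; lia.
have [|m le_nm|q qE] := IH (p - p@_(n%:Z) *: t ^+ n).
- rewrite raddfB; congr (_ - _); first exact: p_fix.
  by rewrite /= linearZ /= rmorphXn /= [laurent_flip t]laurent_trace_flip.
- rewrite mcoeffB mcoeffZ laurent_coef_trace_exp //; case: eqP => [->|ne_mn].
    by rewrite mulr1 subrr.
  by rewrite mulr0 subr0 p0 //; lia.
exists (q + p@_(n%:Z) *: 'X^n); rewrite rmorphD /= -qE -mul_polyC rmorphM /=.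
by rewrite horner_algC rmorphXn /= horner_algX -scalerAl mul1r subrK.
Qed.

End FixedRing.

(** * The center for [sigma_inv] and its isomorphism with [laurent {poly k}] *)

Section Center.
Variable k : fieldType.

Local Notation sigma := (sigma_inv k).
Local Notation A := (gwa sigma 1).
Local Notation const := (gwa_const sigma 1).
Local Notation Xz := (@gwa_Xz k _ sigma).
Local Notation ht := (horner_alg (laurent_trace k)).
Implicit Types (r : laurent k) (q : {poly k}) (i j m : int).
Implicit Types (p : laurent {poly k}) (z : A).

Lemma aut_pow_flipD2 i r : aut_pow sigma (i + 2) r = aut_pow sigma i r.
Proof. by rewrite (addrA i 1 1) !aut_powS /= laurent_flipK. Qed.

Lemma aut_pow_flip_double j r : aut_pow sigma (j + j) r = r.
Proof.
elim/int_rect: j => [|n IH|n IH] //.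
  by rewrite -[RHS]IH -[RHS]aut_pow_flipD2; congr aut_pow; lia.
by rewrite -[RHS]IH -[LHS]aut_pow_flipD2; congr aut_pow; lia.
Qed.

Lemma center_coef_odd z j : z \in @in_center k A ->
  gwa_coef (j + j + 1) z = 0.
Proof.
move=> /(gwa_center_coef_const (laurentX k 1) (j + j + 1)).
rewrite aut_powS aut_pow_flip_double /= laurent_flipX.
set r := gwa_coef _ z => rh; apply/malgP => m; rewrite mcoeff0.
(* [r h^-1 = h r] makes the coefficients of [r] 2-periodic. *)
have rS n : r@_(n + 1 + 1) = r@_n.
  have /(congr1 (mcoeff (n + 1))) := rh.
  by rewrite (mulrC (laurentX _ _)) !laurent_coefMX opprK addrK.
have rn (n : nat) i : r@_(i + (n + n)%:Z) = r@_i.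
  elim: n => [|n IH]; first by rewrite addr0.
  by rewrite -[RHS]IH -[RHS]rS; congr (r@__); lia.
have [N rN] := laurent_coef_eventually0 r.
(* Shifting [m] by [2 (N + |m|)] moves it past [N], where [r] vanishes. *)
by rewrite -(rn (N + `|m|)%N) rN //; lia.
Qed.

(** Even powers of [x] twist constants by even powers of the flip, which are trivial. *)
Lemma gwa_Xz_double_center j : Xz (j + j) \in @in_center k A.
Proof.
apply: gwa_in_center => [r|].
  by rewrite gwa_Xz_const aut_pow_flip_double.
by rewrite -[gwa_x _ _]expr1 -[_ ^+ 1]/(Xz 1) -!gwa_XzD addrC.
Qed.

Lemma gwa_const_flip_center r : sigma r = r -> const r \in @in_center k A.
Proof.
move=> r_fix; apply: gwa_in_center => [s|]; first by rewrite -!rmorphM mulrC.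
by rewrite gwa_x_const r_fix.
Qed.

(** Sends the polynomial variable to [h + h^-1] and the Laurent variable to [x^2]. *)
Definition center_map p : A :=
  mmap (const \o ht) (fun j => Xz (j + j)) p.

Lemma center_mapM q j : center_map (laurentM q j) = const (ht q) * Xz (j + j).
Proof. exact: mmapU. Qed.

Lemma center_map_is_additive : zmod_morphism center_map.
Proof. by move=> p p'; apply: raddfB. Qed.

Lemma center_map_is_multiplicative : monoid_morphism center_map.
Proof.
split; first by rewrite laurent1E center_mapM !rmorph1 mulr1.
have cD p p' : center_map (p + p') = center_map p + center_map p' by apply: raddfD.
have c0 : center_map 0 = 0 by apply: raddf0.
move=> p p'; elim/laurent_ind: p => [|p1 p2 IH1 IH2|q i].
- by rewrite mul0r c0 mul0r.
- by rewrite mulrDl !cD mulrDl IH1 IH2.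
elim/laurent_ind: p' => [|p1 p2 IH1 IH2|q' j].
- by rewrite mulr0 c0 mulr0.
- by rewrite mulrDr !cD mulrDr IH1 IH2.
rewrite laurentMM !center_mapM addrACA (gwa_XzD _ (i + i)) !rmorphM /= -!mulrA.
(* What remains is to move the central [x^(2i)] past the constant [ht q']. *)
congr (_ * _); rewrite !mulrA; congr (_ * _).
by have /in_centerP -> := gwa_Xz_double_center i.
Qed.

Lemma center_map_center p : center_map p \in @in_center k A.
Proof.
rewrite /center_map mmapE rpred_sum // => j _; apply: rpredM.
  exact/gwa_const_flip_center/horner_trace_flip.
exact: gwa_Xz_double_center.
Qed.

(** The even coefficients recover [p] up to the injective [ht], whence injectivity of
    [center_map]. *)
Lemma gwa_coef_center_map p j : gwa_coef (j + j) (center_map p) = ht p@_j.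
Proof.
rewrite /center_map mmapE raddf_sum /= [in RHS](monalgE p) !raddf_sum /=.
apply: eq_bigr => i _; rewrite gwa_coef_monomial mcoeffU raddfMn /=.
by congr (_ *+ _); lia.
Qed.

Lemma center_map_inj : injective center_map.
Proof.
move=> p p' eq_pp'; apply/malgP => j; apply: horner_trace_inj.
by rewrite -!gwa_coef_center_map eq_pp'.
Qed.

Lemma center_map_surj z : z \in @in_center k A -> exists p, z = center_map p.
Proof.
move=> zC; have [s zE] := gwa_expansion z.
have sE m : gwa_coef m z = s@_m by rewrite zE gwa_coef_mmap.
(* It suffices to reach each monomial of [z]; its coefficient is constrained by the centrality of
   [z]. *)
rewrite zE mmapE; elim/big_ind: _ => [|z1 z2 [p1 ->] [p2 ->]|i _].
- by exists 0; rewrite /center_map raddf0.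
- by exists (p1 + p2); rewrite /center_map raddfD.
have [j [->|->]] : exists j, i = j + j \/ i = j + j + 1.
  (* Division rounds down, so negative odd [i] also have the form [2j + 1]. *)
  by exists (i %/ 2)%Z; lia.
- have [q qE] := laurent_flip_fixed (gwa_center_coef_fixed (j + j) zC).
  by exists (laurentM q j); rewrite center_mapM -qE sE.
by exists 0; rewrite -sE center_coef_odd // rmorph0 mul0r /center_map raddf0.
Qed.

Definition center_iso p : center A := Center (center_map_center p).

Lemma center_iso_is_additive : zmod_morphism center_iso.
Proof. by move=> p p'; apply: val_inj; apply: center_map_is_additive. Qed.

Lemma center_iso_is_multiplicative : monoid_morphism center_iso.
Proof.
have [c1 cM] := center_map_is_multiplicative.
by split=> [|p p']; apply: val_inj; [apply: c1|apply: cM].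
Qed.

HB.instance Definition _ := GRing.isZmodMorphism.Build (laurent {poly k})
  (center A) center_iso center_iso_is_additive.
HB.instance Definition _ := GRing.isMonoidMorphism.Build (laurent {poly k})
  (center A) center_iso center_iso_is_multiplicative.

Lemma center_iso_bij : bijective center_iso.
Proof.
have surj (z : center A) : exists p, center_iso p = z.
  have [p zE] := center_map_surj (valP z).
  by exists p; apply: val_inj; rewrite /= -zE.
(* Choice provides a right inverse; injectivity makes it two-sided. *)
have [g gK] := choice surj; exists g => // p; apply: center_map_inj.
by have /(congr1 val) := gK (center_iso p).
Qed.

End Center.

(** The ring [k[h + h^-1, x^(+-2)]] is modelled by Laurent polynomials over [{poly k}]; the clauses
    after bijectivity fix [f] on scalars and on both variables. *)
Theorem lemma3p3 (k : fieldType) :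
  exists f : {rmorphism laurent {poly k} -> center (gwa (sigma_inv k) 1)},
    [/\ bijective f,
        forall c : k, f (c%:P)%:A = c%:A,
        val (f 'X%:A) =
          gwa_const (sigma_inv k) 1 (laurentX k 1 + laurentX k (-1))
      & val (f (laurentX {poly k} 1)) = gwa_x (sigma_inv k) 1 ^+ 2].
Proof.
have val_const q : val (center_iso q%:A) =
    gwa_const (sigma_inv k) 1 (horner_alg (laurent_trace k) q).
  by rewrite /= laurent1E laurentZM mulr1 center_mapM mulr1.
exists (@center_iso k); split; first exact: center_iso_bij.
- move=> c; apply: val_inj; rewrite val_const horner_algC.
  by rewrite linearZ rmorph1 [RHS]linearZ rmorph1.
- by rewrite val_const horner_algX.
by rewrite /= center_mapM rmorph1 rmorph1 mul1r.
Qed.
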